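(* Let $(I,\mathscr{I},\nu)$ be a probability space and $\{T_i\}_{i\in I}$ a family of maximal monotone operators on $\mathbb{R}^k$, let $\lambda>0$ and $\alpha\in(0,2)$, and assume $(i,x)\mapsto J_{\lambda T_i}(x)$ is measurable, where $J_{\lambda T}=(\mathrm{Id}+\lambda T)^{-1}$ denotes the resolvent. Let $$Z=\{x^\ast\in\mathbb{R}^k\colon 0\in T_i(x^\ast)\text{ for } \nu\text{-almost every } i\}$$ and assume $Z\neq\emptyset$. Let $(\xi_n)$ be an ergodic stationary sequence of $I$-valued random variables with distribution $\nu$, and for any $x_0\in\mathbb{R}^k$ define $X_0=x_0$, $X_{n+1}=X_n+\alpha\,(J_{\lambda T_{\xi_n}}(X_n)-X_n)$. Then $(X_n)$ converges almost surely to a random variable $X$ with $X\in Z$ almost surely.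
   Context: An operator $T\colon\mathbb{R}^k\to\mathcal{P}(\mathbb{R}^k)$ is monotone if $\langle x'-x,v'-v\rangle\ge 0$ whenever $v\in T(x)$, $v'\in T(x')$; it is maximal monotone if its graph is not properly contained in the graph of another monotone operator. For maximal monotone $T$ and $\lambda>0$, the resolvent $J_{\lambda T}=(\mathrm{Id}+\lambda T)^{-1}$ is single-valued and defined on all of $\mathbb{R}^k$. A sequence $(\xi_n)$ is ergodic stationary if its law on $I^{\mathbb{N}}$ is invariant and ergodic under the left shift. *)

(* Defs.v *)
From HB Require Import structures.
From mathcomp Require Import all_boot all_order all_algebra.
From mathcomp Require Import all_classical all_reals all_analysis.
Set Implicit Arguments. Unset Strict Implicit. Unset Printing Implicit Defensive.
Import Order.TTheory GRing.Theory Num.Theory numFieldNormedType.Exports.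
Local Open Scope classical_set_scope.
Local Open Scope ring_scope.

Section Defs.
Variable R : realType.

Definition inner k (x y : 'rV[R]_k) : R := \sum_(i < k) x ord0 i * y ord0 i.

Definition monotone k (T : 'rV[R]_k -> set 'rV[R]_k) : Prop :=
  forall x x' v v', T x v -> T x' v' -> 0 <= inner (x' - x) (v' - v).

Definition maximal_monotone k (T : 'rV[R]_k -> set 'rV[R]_k) : Prop :=
  monotone T /\
  forall S : 'rV[R]_k -> set 'rV[R]_k, monotone S ->
    (forall x v, T x v -> S x v) -> forall x v, S x v -> T x v.

(* Resolvent J_{lam T} = (Id + lam T)^{-1}: J x is the y with x \in y + lam T(y),
   i.e. lam^-1 (x - y) \in T y (unique when T is maximal monotone, lam > 0). *)
Definition resolvent k (lam : R) (T : 'rV[R]_k -> set 'rV[R]_k) (x : 'rV[R]_k)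
  : 'rV[R]_k := xget 0 [set y | T y (lam^-1 *: (x - y))].

Definition borel_vec k : set (set 'rV[R]_k) := <<s [set A | open A] >>.

Definition prod_sigma d (I : measurableType d) k : set (set (I * 'rV[R]_k)) :=
  <<s [set C | exists A B, measurable A /\ borel_vec B /\ C = A `*` B] >>.

Definition jointly_measurable d (I : measurableType d) k
  (J : I -> 'rV[R]_k -> 'rV[R]_k) : Prop :=
  forall B, borel_vec B -> prod_sigma (I:=I) (k:=k) ((fun p => J p.1 p.2) @^-1` B).

Definition zero_set d (I : measurableType d) (nu : probability I R) k
  (T : I -> 'rV[R]_k -> set 'rV[R]_k) : set 'rV[R]_k :=
  [set x | {ae nu, forall i, T i x 0}].
End Defs.

Definition seq_sigma d (I : measurableType d) : set (set (nat -> I)) :=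
  <<s [set C | exists n A, measurable A /\ C = (fun w : nat -> I => w n) @^-1` A] >>.

Definition shift {I : Type} (w : nat -> I) : nat -> I := fun n => w n.+1.

Definition path_of {O I : Type} (xi : nat -> O -> I) (o : O) : nat -> I :=
  fun n => xi n o.

Definition stationary (R : realType) d (I : measurableType d) d' (O : measurableType d')
  (P : probability O R) (xi : nat -> O -> I) : Prop :=
  forall B, seq_sigma B ->
    P (path_of xi @^-1` ((@shift I) @^-1` B)) = P (path_of xi @^-1` B).

Definition ergodic (R : realType) d (I : measurableType d) d' (O : measurableType d')
  (P : probability O R) (xi : nat -> O -> I) : Prop :=
  forall B, seq_sigma B -> (@shift I) @^-1` B = B ->
    P (path_of xi @^-1` B) = 0%E \/ P (path_of xi @^-1` B) = 1%E.

Fixpoint km_iter (R : realType) (I O : Type) k (J : I -> 'rV[R]_k -> 'rV[R]_k)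
  (alpha : R) (xi : nat -> O -> I) (x0 : 'rV[R]_k) (n : nat) (o : O) : 'rV[R]_k :=
  match n with
  | 0 => x0
  | m.+1 => let y := km_iter J alpha xi x0 m o in y + alpha *: (J (xi m o) y - y)
  end.

(* Main.v *)
Require Import Defs.
From HB Require Import structures.
From mathcomp Require Import all_boot all_order all_algebra.
From mathcomp Require Import all_classical all_reals all_analysis.
From mathcomp Require Import measurable_realfun ring lra.
Set Implicit Arguments. Unset Strict Implicit. Unset Printing Implicit Defensive.
Import Order.TTheory GRing.Theory Num.Theory numFieldNormedType.Exports.
Local Open Scope classical_set_scope.
Local Open Scope ring_scope.

(** Minty's theorem makes every resolvent [J_i] total and firmly nonexpansive,
    with fixed points the zeros of [T_i].  As [Z] is separable, almost surely
    every [J_{xi_n}] fixes all of [Z]; the relaxed iteration is then Fejer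
    monotone with respect to [Z], and both its residuals
    [|J_{xi_n} X_n - X_n|] and its increments tend to [0].

    It remains to find a cluster point in [Z], for which recurrence suffices (no
    ergodic averages are needed).  A point outside [Z] has a rational neighbour
    [q] whose residual [|J_i q - q|] exceeds some rational [r] with positive
    [nu]-probability.  For any finite set of such pairs [(q, r)], ergodicity
    gives a length [m] such that infinitely many blocks of length [m] contain,
    for each of the pairs, an index with residual at [q] above [r].  Late in the
    trajectory [X] hardly moves along a block and has small residuals there, so a
    cluster point of [X] along such blocks cannot be close to any of the [q]. *)

(** * The Euclidean inner product and norm on row vectors *)

Section Euclidean.
Variables (R : realType) (k : nat).
Implicit Types x y z u v : 'rV[R]_k.

Lemma innerC x y : inner x y = inner y x.
Proof. by apply: eq_bigr => i _; rewrite mulrC. Qed.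

Lemma innerDl x y z : inner (x + y) z = inner x z + inner y z.
Proof. by rewrite -big_split; apply: eq_bigr => i _; rewrite mxE mulrDl. Qed.

Lemma innerZl a x z : inner (a *: x) z = a * inner x z.
Proof. by rewrite /inner mulr_sumr; apply: eq_bigr => i _; rewrite mxE mulrA. Qed.

Lemma innerNl x z : inner (- x) z = - inner x z.
Proof. by rewrite -scaleN1r innerZl mulN1r. Qed.

Lemma innerDr x y z : inner z (x + y) = inner z x + inner z y.
Proof. by rewrite innerC innerDl !(innerC z). Qed.

Lemma innerZr a x z : inner z (a *: x) = a * inner z x.
Proof. by rewrite innerC innerZl innerC. Qed.

Lemma innerNr x z : inner z (- x) = - inner z x.
Proof. by rewrite innerC innerNl innerC. Qed.

Definition innerE := (innerDl, innerDr, innerNl, innerNr, innerZl, innerZr).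

Lemma inner0l z : inner 0 z = 0.
Proof. by apply: big1 => i _; rewrite mxE mul0r. Qed.

Lemma inner_suml n (t : 'I_n -> 'rV[R]_k) z :
  inner (\sum_i t i) z = \sum_i inner (t i) z.
Proof.
apply: (big_morph (fun x => inner x z)) => [x y|]; first exact: innerDl.
exact: inner0l.
Qed.

Lemma inner_ge0 x : 0 <= inner x x.
Proof. by apply: sumr_ge0 => i _; rewrite -expr2 sqr_ge0. Qed.

Lemma continuous_inner (T : topologicalType) (f g : T -> 'rV[R]_k) :
  continuous f -> continuous g -> continuous (fun t => inner (f t) (g t)).
Proof.
move=> cf cg; apply: continuous_big => [|i _ t].
  exact: add_continuous.
apply: (@continuousM _ _ (fun t => f t ord0 i) (fun t => g t ord0 i)).
  apply: (@continuous_comp _ _ _ f (fun v : 'rV[R]_k => v ord0 i)); first exact: cf.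
  exact: coord_continuous.
apply: (@continuous_comp _ _ _ g (fun v : 'rV[R]_k => v ord0 i)); first exact: cg.
exact: coord_continuous.
Qed.

(** Balls of row vectors are coordinatewise; the Euclidean norm is kept apart because firm
    nonexpansiveness and Fejer monotonicity speak of the inner product. *)
Definition enorm x : R := Num.sqrt (inner x x).

Lemma enorm_ge0 x : 0 <= enorm x.
Proof. exact: sqrtr_ge0. Qed.

Lemma enorm_sqr x : enorm x ^+ 2 = inner x x.
Proof. by rewrite sqr_sqrtr // inner_ge0. Qed.

Lemma ler_enorm x y : (enorm x <= enorm y) = (inner x x <= inner y y).
Proof. by rewrite ler_sqrt // inner_ge0. Qed.

Lemma enormN x : enorm (- x) = enorm x.
Proof. by rewrite /enorm innerNl innerNr opprK. Qed.

Lemma enormC x y : enorm (x - y) = enorm (y - x).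
Proof. by rewrite -enormN opprB. Qed.

Lemma enormZ a x : enorm (a *: x) = `|a| * enorm x.
Proof.
by rewrite /enorm innerZl innerZr mulrA -expr2 sqrtrM ?sqr_ge0 // sqrtr_sqr.
Qed.

Lemma coord_le_enorm x i : `|x ord0 i| <= enorm x.
Proof.
rewrite -sqrtr_sqr ler_sqrt ?inner_ge0 // /inner (bigD1 i) //= expr2 lerDl.
by apply: sumr_ge0 => j _; rewrite -expr2 sqr_ge0.
Qed.

Lemma enorm_eq0 x : enorm x = 0 -> x = 0.
Proof.
move=> x0; apply/rowP => i; rewrite mxE; apply/eqP.
by rewrite -normr_le0 -x0 coord_le_enorm.
Qed.

Lemma inner_le_enorm x y : inner x y <= enorm x * enorm y.
Proof.
have [/enorm_eq0 ->|x0] := eqVneq (enorm x) 0.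
  by rewrite inner0l mulr_ge0 ?enorm_ge0.
have [/enorm_eq0 ->|y0] := eqVneq (enorm y) 0.
  by rewrite innerC inner0l mulr_ge0 ?enorm_ge0.
have px : 0 < enorm x by rewrite lt_neqAle eq_sym x0 enorm_ge0.
have py : 0 < enorm y by rewrite lt_neqAle eq_sym y0 enorm_ge0.
(* Expanding this square gives twice the product of the norms times the gap in the Cauchy-Schwarz
   inequality. *)
have := inner_ge0 (enorm y *: x - enorm x *: y).
rewrite !innerE (innerC y x) -!enorm_sqr.
set a := enorm x; set b := enorm y; set c := inner x y => H.
have {}H : 0 <= (2 * (a * b)) * (a * b - c).
  by apply: le_trans H _; rewrite le_eqVlt; apply/orP; left; apply/eqP; ring.
by rewrite pmulr_rge0 ?subr_ge0 // in H; rewrite !mulr_gt0.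
Qed.

Lemma ler_enormD x y : enorm (x + y) <= enorm x + enorm y.
Proof.
rewrite -(@ler_pXn2r _ 2) ?nnegrE ?addr_ge0 ?enorm_ge0 //.
rewrite enorm_sqr !innerE (innerC y x) -!enorm_sqr.
have := inner_le_enorm x y; nra.
Qed.

Lemma ler_enorm_dist x y z : enorm (x - z) <= enorm (x - y) + enorm (y - z).
Proof. by have := ler_enormD (x - y) (y - z); rewrite addrA subrK. Qed.

Lemma enorm_le_sum x : enorm x <= \sum_(i < k) `|x ord0 i|.
Proof.
have S0 (r : seq 'I_k) : 0 <= \sum_(i <- r) `|x ord0 i| by apply: sumr_ge0.
rewrite -(@ler_pXn2r _ 2) ?nnegrE ?enorm_ge0 // enorm_sqr /inner.
elim: (index_enum 'I_k) => [|i r IH]; first by rewrite !big_nil expr0n.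
rewrite !big_cons -expr2 -(@real_normK _ (x ord0 i)) ?num_real //.
have := mulr_ge0 (normr_ge0 (x ord0 i)) (S0 r).
move: (S0 r) IH; set p := \sum_(i <- r) `|_|; set q := \sum_(j <- r) _.
set c := `|_| => p0 qp cp; rewrite sqrrD.
by apply: le_trans (_ : c ^+ 2 + p ^+ 2 <= _); [exact: lerD|lra].
Qed.

Lemma enorm_lt_delta (e : R) : 0 < e ->
  exists2 d : R, 0 < d & forall x, (forall i, `|x ord0 i| < d) -> enorm x < e.
Proof.
(* Dividing by [k.+1] keeps the final bound strict and covers [k = 0]. *)
move=> e0; exists (e / k.+1%:R) => [|x xd]; first by rewrite divr_gt0.
apply: le_lt_trans (enorm_le_sum x) _.
apply: (@le_lt_trans _ _ (\sum_(i < k) e / k.+1%:R)).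
  by apply: ler_sum => i _; exact/ltW.
rewrite sumr_const card_ord -(mulr_natr _ k) -mulrA gtr_pMr // mulrC.
rewrite ltr_pdivrMr // mul1r.
by rewrite ltr_nat.
Qed.

Lemma enorm_continuous : continuous enorm.
Proof.
move=> x; apply: (@continuous_comp _ _ _ (fun x => inner x x) Num.sqrt).
  by apply: (@continuous_inner _ id id) => ?; exact: cvg_id.
exact: sqrt_continuous.
Qed.

Lemma cvg_enormP (x : nat -> 'rV[R]_k) l :
  (forall e : R, 0 < e -> exists N, forall n, (N <= n)%N -> enorm (x n - l) < e) ->
  x n @[n --> \oo] --> l.
Proof.
move=> H; apply/cvg_ballP => e e0; have [N HN] := H _ e0.
exists N => // n /= Nn; split=> // i j; rewrite ord1 -ball_normE /ball_ /=.
have := HN _ Nn; apply: le_lt_trans.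
by have := coord_le_enorm (l - x n) j; rewrite enormC !mxE.
Qed.

Lemma enorm_ball_compact (M : R) : compact [set x : 'rV[R]_k | enorm x <= M].
Proof.
apply: (@subclosed_compact _ _ [set v : 'rV[R]_k | forall i, `[(- M), M]%classic (v ord0 i)]).
- rewrite (_ : [set _ | _] = enorm @^-1` [set y | y <= M]) //.
  by move/continuous_closedP: enorm_continuous; apply; exact: closed_le.
- by apply: (@rV_compact _ _ (fun=> `[(- M), M]%classic)) => _; exact: segment_compact.
- move=> x /= xM i; rewrite in_itv /= -ler_norml.
  exact: le_trans (coord_le_enorm x i) xM.
Qed.

Lemma bounded_seq_cluster (x : nat -> 'rV[R]_k) (M : R) :
  (forall n, enorm (x n) <= M) ->
  exists l, forall e : R, 0 < e -> forall N, exists2 n, (N <= n)%N & enorm (x n - l) < e.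
Proof.
move=> xM.
have [|l [_ cl]] := enorm_ball_compact (F := x n @[n --> \oo]) _ (M := M).
  by exists 0%N => // n _; exact: xM.
exists l => e e0 N; have [d d0 dP] := enorm_lt_delta e0.
have [|_ [[n Nn <-] bl]] := cl (x @` [set n | (N <= n)%N]) _ _ (nbhsx_ballx l d d0).
  by exists N => // n /= Nn; exists n.
exists n => //; apply: dP => i; case: bl => _ /(_ ord0 i).
by rewrite -ball_normE /ball_ /= distrC !mxE.
Qed.

End Euclidean.

(** * Minty's theorem for finite families, by duality over a simplex *)

Lemma le0_of_quadratic_bound (R : realType) (d D : R) : 0 <= D ->
  (forall s, 0 < s <= 1 -> s * d <= s ^+ 2 * D) -> d <= 0.
Proof.
move=> D0 H; rewrite leNgt; apply/negP => d0.
have dD : 0 < d + D by lra.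
(* If [0 < d], the bound already fails at [s = d / (d + D)]. *)
have s0 : 0 < d / (d + D) by rewrite divr_gt0.
have /H : 0 < d / (d + D) <= 1 by rewrite s0 /= ler_pdivrMr // mul1r lerDl.
rewrite expr2 -mulrA ler_pM2l // mulrAC ler_pdivlMr // mulrDr gerDr.
by rewrite leNgt mulr_gt0.
Qed.

Section FiniteMinty.
Variables (R : realType) (k n : nat) (a b : 'I_n.+1 -> 'rV[R]_k).

Let simplex : set 'rV[R]_n.+1 :=
  [set t | (forall i, 0 <= t ord0 i) /\ \sum_i t ord0 i = 1].

Let simplex_compact : compact simplex.
Proof.
have cS : compact [set v : 'rV[R]_n.+1 | forall i, `[(0 : R), 1]%classic (v ord0 i)].
  by apply: (@rV_compact _ _ (fun=> `[(0 : R), 1]%classic)) => _; exact: segment_compact.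
have cs : continuous (fun t : 'rV[R]_n.+1 => \sum_i t ord0 i).
  apply: continuous_big => [|i _ t]; first exact: add_continuous.
  exact: coord_continuous.
rewrite (_ : simplex = [set v | forall i, `[(0 : R), 1]%classic (v ord0 i)] `&`
   (fun t => \sum_i t ord0 i) @^-1` [set y | y = 1]); last first.
  apply/seteqP; split=> t /= [t0 t1]; split=> // i; last first.
    by have := t0 i; rewrite in_itv /= => /andP[].
  rewrite in_itv /= t0 -t1 (bigD1 i) //= lerDl; exact: sumr_ge0.
apply: compact_closedI cS _.
by move/continuous_closedP: cs; apply; exact: closed_eq.
Qed.

Let comb (F : 'I_n.+1 -> 'rV[R]_k) (t : 'rV[R]_n.+1) := \sum_i t ord0 i *: F i.
(** For [t] in the simplex, the average with weights [t] of [- inner (a i - y) (b i + y)] is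
    [inner y y - 2 * inner (comb c t) y - h t]; it is least at [y = comb c t], with value [g t]. *)
Let c i := 2^-1 *: (a i - b i).
Let h (t : 'rV[R]_n.+1) := \sum_i t ord0 i * inner (a i) (b i).
Let g t := - inner (comb c t) (comb c t) - h t.

Let continuous_g : continuous g.
Proof.
have cc : continuous (comb c).
  apply: continuous_big => [|i _ t]; first exact: add_continuous.
  by apply: continuousZr_tmp => ?; exact: coord_continuous.
have ch : continuous h.
  apply: continuous_big => [|i _ t]; first exact: add_continuous.
  apply: (@continuousM _ _ (fun t : 'rV[R]_n.+1 => t ord0 i) (fun=> _)).
    exact: coord_continuous.
  exact: cst_continuous.
move=> t; apply: (@continuousB _ R _ (fun t => - inner (comb c t) (comb c t)) h).
  apply: (@continuousN _ R _ (fun t => inner (comb c t) (comb c t))).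
  exact: (continuous_inner cc cc).
exact: ch.
Qed.

Let inner_combl F t u : inner (comb F t) u = \sum_i t ord0 i * inner (F i) u.
Proof. by rewrite inner_suml; apply: eq_bigr => i _; rewrite innerZl. Qed.

Let inner_combr F t u : inner u (comb F t) = \sum_i t ord0 i * inner u (F i).
Proof. by rewrite innerC inner_combl; apply: eq_bigr => i _; rewrite innerC. Qed.

Hypothesis ab_monotone : forall i j, 0 <= inner (a i - a j) (b i - b j).

(** Averaging monotonicity over all pairs bounds the inner product of the barycentres [A] of [a] and
    [B] of [b] by [h t]; hence [g t] is at most [- |A - B|^2 / 4 - <A, B> = - |A + B|^2 / 4]. *)
Let g_le0 t : simplex t -> g t <= 0.
Proof.
move=> [t0 t1].
have H i : 0 <= inner (a i) (b i) - inner (a i) (comb b t)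
                 - inner (comb a t) (b i) + h t.
  rewrite inner_combl inner_combr -[inner (a i) (b i)]mul1r -t1 mulr_suml.
  rewrite -!sumrB -big_split; apply: sumr_ge0 => j _ /=.
  rewrite -!mulrBr -mulrDr; apply: mulr_ge0 => //.
  by have := ab_monotone i j; rewrite !innerE; lra.
have {}H : inner (comb a t) (comb b t) <= h t.
  suff : 0 <= 2 * (h t - inner (comb a t) (comb b t)) by lra.
  have : 0 <= \sum_i t ord0 i * (inner (a i) (b i) - inner (a i) (comb b t)
                 - inner (comb a t) (b i) + h t).
    by apply: sumr_ge0 => i _; exact: mulr_ge0.
  under eq_bigr do rewrite mulrDr !mulrBr.
  rewrite big_split /= !sumrB -mulr_suml t1 -inner_combl -inner_combr -/(h t).
  by lra.
have -> : g t = - inner (2^-1 *: (comb a t - comb b t)) (2^-1 *: (comb a t - comb b t)) - h t.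
  have -> // : 2^-1 *: (comb a t - comb b t) = comb c t.
  rewrite -sumrB scaler_sumr; apply: eq_bigr => i _.
  by rewrite -scalerBr !scalerA mulrC.
have := inner_ge0 (comb a t + comb b t).
by rewrite !innerE (innerC (comb b t) (comb a t)); lra.
Qed.

(* [g] is the Lagrange dual of minimising [max_i - inner (a i - y) (b i + y)]
   over [y]; its maximiser [t] on the simplex yields the point [comb c t]. *)
Lemma finite_minty : exists y, forall i, 0 <= inner (a i - y) (b i + y).
Proof.
have S0 : simplex !=set0.
  exists (delta_mx ord0 ord0); split=> [i|]; first by rewrite mxE ler0n.
  rewrite (bigD1 ord0) //= mxE !eqxx big1 ?addr0 // => i i0.
  by rewrite mxE (negbTE i0) andbF.
have [t /[!inE] tS tmax] :=
  EVT_max_rV S0 simplex_compact (continuous_subspaceT continuous_g).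
exists (comb c t) => i; set y := comb c t.
suff : - inner (a i - y) (b i + y) - g t <= 0 by have := g_le0 tS; lra.
apply: (@le0_of_quadratic_bound _ _ (inner (c i - y) (c i - y))) => [|s s01].
  exact: inner_ge0.
(* Moving [t] towards vertex [i] changes [g] by [s] times the quantity to be bounded, minus [s ^+ 2]
   times [inner (c i - y) (c i - y)]; maximality of [t] makes this change nonpositive. *)
pose t' : 'rV[R]_n.+1 := (1 - s) *: t + s *: delta_mx ord0 i.
have t'E j : t' ord0 j = (1 - s) * t ord0 j + s * (j == i)%:R by rewrite !mxE.
have St' : simplex t'.
  case: tS => t0 t1; split=> [j|].
    rewrite t'E addr_ge0 // mulr_ge0 ?ler0n //; lra.
  under eq_bigr do rewrite t'E.
  rewrite big_split -!mulr_sumr t1 (bigD1 i) //= eqxx big1 => [|j /negbTE -> //].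
  by rewrite addr0 !mulr1 subrK.
have ct' : comb c t' = (1 - s) *: y + s *: c i.
  rewrite /comb; under eq_bigr do rewrite t'E scalerDl -!scalerA.
  rewrite big_split -!scaler_sumr; congr (_ + _ *: _).
  rewrite (bigD1 i) //= eqxx scale1r big1 ?addr0 // => j /negbTE ->.
  by rewrite scale0r.
have ht' : h t' = (1 - s) * h t + s * inner (a i) (b i).
  rewrite /h; under eq_bigr do rewrite t'E mulrDl -!mulrA.
  rewrite big_split -!mulr_sumr; congr (_ + _ * _).
  rewrite (bigD1 i) //= eqxx mul1r big1 ?addr0 // => j /negbTE ->.
  by rewrite mul0r.
have /tmax : t' \in simplex by rewrite inE.
rewrite /g ct' ht' -/y => H; rewrite -subr_ge0 in H; rewrite -subr_ge0.
apply: le_trans H _; rewrite le_eqVlt; apply/orP; left; apply/eqP.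
rewrite /c !innerE (innerC y (a i)) (innerC y (b i)) (innerC (b i) (a i)).
by field.
Qed.

End FiniteMinty.

(** * Minty's theorem and the resolvent *)

Section Minty.
Variables (R : realType) (k : nat).
Implicit Types T : 'rV[R]_k -> set 'rV[R]_k.

(** An empty graph would be properly extended by the single pair [(0, 0)]. *)
Lemma maximal_monotone_nonempty T : maximal_monotone T -> exists x v, T x v.
Proof.
move=> [_ maxT]; apply: contrapT => nT.
suff : T 0 0 by move=> T00; apply: nT; exists 0, 0.
apply: (maxT (fun x v => x = 0 /\ v = 0)) => //.
- by move=> x x' v v' [-> ->] [-> ->]; exact: inner_ge0.
- by move=> x v Txv; exfalso; apply: nT; exists x, v.
Qed.

(** Adjoining [(x, v)] to the graph keeps it monotone, so maximality forces the pair to be there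
    already. *)
Lemma maximal_monotoneP T x v : maximal_monotone T ->
  (forall u w, T u w -> 0 <= inner (u - x) (w - v)) -> T x v.
Proof.
move=> [monoT maxT] H.
apply: (maxT (fun y w => T y w \/ (y = x /\ w = v))); last by right.
- move=> y y' w w' [Tyw|[-> ->]] [Tyw'|[-> ->]]; last by rewrite !subrr inner0l.
  + exact: monoT.
  + by rewrite -(opprB y) -(opprB w) innerNl innerNr opprK; exact: H.
  + exact: H.
- by move=> y w; left.
Qed.

(** A single constraint confines [y] to a ball, which supplies the compactness in Minty's theorem:
    it reads [|y|^2 <= inner (a - b) y + inner a b], and Cauchy-Schwarz applies. *)
Lemma minty_ball_bound (a b y : 'rV[R]_k) : 0 <= inner (a - y) (b + y) ->
  enorm y <= enorm (a - b) + enorm a + enorm b.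
Proof.
rewrite !innerE -enorm_sqr (innerC y b) => H.
have := inner_le_enorm (a - b) y; have := inner_le_enorm a b.
rewrite !innerE => ab aby.
have := enorm_ge0 a; have := enorm_ge0 b; have := enorm_ge0 (a - b).
have := enorm_ge0 y; set p := enorm y in H aby *; set q := enorm (a - b) in aby *.
set r := enorm a in ab *; set s := enorm b in ab * => p0 q0 s0 r0.
rewrite leNgt; apply/negP => lt; nra.
Qed.

(** Finite intersection property: each point of the graph puts a closed condition on [y], any
    finitely many are solvable by [finite_minty], and a base point keeps all solutions in one
    compact ball. A common solution belongs to the graph by maximality. *)
Lemma minty T (lam : R) x : maximal_monotone T -> 0 < lam ->
  exists y, T y (lam^-1 *: (x - y)).
Proof.
move=> mT lam0; have [u0 [v0 Tuv0]] := maximal_monotone_nonempty mT.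
pose D := [set p : 'rV[R]_k * 'rV[R]_k | T p.1 p.2].
(* [S p] says that [(y, lam^-1 *: (x - y))] is monotonically related to [p], with the factor [lam]
   cleared. *)
pose S (p : 'rV[R]_k * 'rV[R]_k) :=
  [set y : 'rV[R]_k | 0 <= inner (p.1 - y) (lam *: p.2 - x + y)].
pose K := [set y : 'rV[R]_k |
  enorm y <= enorm (u0 - (lam *: v0 - x)) + enorm u0 + enorm (lam *: v0 - x)].
have := @enorm_ball_compact R k
  (enorm (u0 - (lam *: v0 - x)) + enorm u0 + enorm (lam *: v0 - x)).
rewrite -/K compact_In0 => /(_ _ D (fun p => K `&` S p)) [].
- exists S => // p _.
  have cS : continuous (fun y : 'rV[R]_k => inner (p.1 - y) (lam *: p.2 - x + y)).
    apply: continuous_inner => y.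
      apply: (@continuousB _ _ _ (fun=> p.1) id); last exact: cvg_id.
      exact: cst_continuous.
    apply: (@continuousD _ _ _ (fun=> lam *: p.2 - x) id); last exact: cvg_id.
    exact: cst_continuous.
  exact: ((continuous_closedP _).1 cS _ (closed_ge (y := 0))).
(* Putting the base point first makes the list nonempty and gives the ball bound at index [0]; it is
   also the default of [nth]. *)
- move=> D' D'D; pose s := (u0, v0) :: finmap.enum_fset D'.
  have sD i : T (nth (u0, v0) s i).1 (nth (u0, v0) s i).2.
    case: i => //= i; have [iD'|/(nth_default _) -> //] := ltnP i (size (finmap.enum_fset D')).
    by have /D'D := mem_nth (u0, v0) iD'; rewrite inE.
  have [|y yP] := @finite_minty R k (size (finmap.enum_fset D'))
    (fun i => (nth (u0, v0) s i).1) (fun i => lam *: (nth (u0, v0) s i).2 - x).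
    move=> i j; rewrite opprB addrA subrK -scalerBr innerZr mulr_ge0 ?(ltW lam0) //.
    by apply: (proj1 mT).
  exists y => p /= pD'; split; first by apply: minty_ball_bound; exact: (yP ord0).
  have ip : (index p s < (size (finmap.enum_fset D')).+1)%N.
    by rewrite -[X in (_ < X)%N]/(size s) index_mem inE pD' orbT.
  by have := yP (Ordinal ip); rewrite /= -/s nth_index // inE pD' orbT.
- move=> y yP; exists y; apply: maximal_monotoneP => // u w Tuw.
  have [_] := yP (u, w) Tuw; rewrite /S /= => H.
  rewrite (_ : w - _ = lam^-1 *: (lam *: w - x + y)).
    by rewrite innerZr mulr_ge0 // invr_ge0 ltW.
  rewrite -addrA [RHS]scalerDr scalerA mulVf ?gt_eqF // scale1r.
  by rewrite -scalerN opprB [- x + y]addrC.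
Qed.

Section Resolvent.
Variables (T : 'rV[R]_k -> set 'rV[R]_k) (lam : R).
Hypotheses (mT : maximal_monotone T) (lam0 : 0 < lam).
Local Notation J := (resolvent lam T).

Lemma resolventP x : T (J x) (lam^-1 *: (x - J x)).
Proof. exact: (@xgetPex _ 0 [set y | T y (lam^-1 *: (x - y))] (minty x mT lam0)). Qed.

Lemma resolvent_firmly_nonexpansive x y :
  inner (J x - J y) (J x - J y) <= inner (J x - J y) (x - y).
Proof.
have := (proj1 mT) _ _ _ _ (resolventP y) (resolventP x).
rewrite -scalerBr innerZr pmulr_rge0 ?invr_gt0 //.
by rewrite !innerE; lra.
Qed.

(** For a zero [x], monotonicity against the graph point at [J x] makes [- |x - J x|^2]
    nonnegative. *)
Lemma resolvent_fixP x : T x 0 <-> J x = x.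
Proof.
split=> [Tx0|Jx]; last by have := resolventP x; rewrite Jx subrr scaler0.
have := (proj1 mT) _ _ _ _ Tx0 (resolventP x).
rewrite subr0 innerZr pmulr_rge0 ?invr_gt0 // -opprB innerNl oppr_ge0 => H.
apply/eqP; rewrite eq_sym -subr_eq0; apply/eqP/enorm_eq0/eqP.
by rewrite -sqrf_eq0 enorm_sqr eq_le H inner_ge0.
Qed.

End Resolvent.
End Minty.

(** * Residual and Fejer estimates for firmly nonexpansive maps *)

Section FirmlyNonexpansive.
Variables (R : realType) (k : nat).
Implicit Types (J : 'rV[R]_k -> 'rV[R]_k) (x y p : 'rV[R]_k).

Definition firmly_nonexpansive J :=
  forall x y, inner (J x - J y) (J x - J y) <= inner (J x - J y) (x - y).

(** [J - Id] is nonexpansive, since [|u - v| <= |v|] whenever [inner u u <= inner u v]. The constant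
    [1] does not depend on [J], so residuals of varying maps transfer between nearby points. *)
Lemma residual_lipschitz J x y : firmly_nonexpansive J ->
  enorm (J x - x) <= enorm (J y - y) + enorm (x - y).
Proof.
move=> fJ; have -> : J x - x = (J y - y) + ((J x - J y) - (x - y)).
  by apply/rowP => i; rewrite !mxE; ring.
apply: le_trans (ler_enormD _ _) _; rewrite lerD2l ler_enorm.
have := fJ x y; have := inner_ge0 (J x - J y).
move: (J x - J y) (x - y) => u v.
by rewrite !innerE (innerC v u); lra.
Qed.

(** With [w = J x - x] and [u = x - p], firm nonexpansiveness says [inner w u <= - inner w w];
    insert this in the expansion of [|u + alpha w|^2]. *)
Lemma relaxed_step_fejer J (alpha : R) x p : firmly_nonexpansive J ->
  0 <= alpha -> J p = p ->
  inner (x + alpha *: (J x - x) - p) (x + alpha *: (J x - x) - p) <=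
  inner (x - p) (x - p) - alpha * (2 - alpha) * inner (J x - x) (J x - x).
Proof.
move=> fJ a0 Jp; have := fJ x p; rewrite Jp.
have -> : J x - p = (J x - x) + (x - p) by rewrite addrA subrK.
have -> : x + alpha *: (J x - x) - p = (x - p) + alpha *: (J x - x).
  by rewrite addrAC.
move: (J x - x) (x - p) => w u; rewrite !innerE (innerC u w) => H.
have {}H : inner w w + inner w u <= 0 by lra.
have := ler_wpM2l a0 H; rewrite mulr0; lra.
Qed.

End FirmlyNonexpansive.

(** * Convergence of one deterministic relaxed trajectory under a recurrence hypothesis *)

Section RelaxedIteration.
Variables (R : realType) (k : nat) (J : nat -> 'rV[R]_k -> 'rV[R]_k) (alpha : R).
Variables (X : nat -> 'rV[R]_k) (Z : set 'rV[R]_k).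
Hypothesis J_firm : forall n, firmly_nonexpansive (J n).
Hypothesis alpha02 : 0 < alpha < 2.
Hypothesis X_step : forall n, X n.+1 = X n + alpha *: (J n (X n) - X n).
Hypothesis Z_fix : forall p, Z p -> forall n, J n p = p.
Hypothesis Z_nonempty : Z !=set0.

Let alpha_ge0 : 0 <= alpha. Proof. by case/andP: alpha02 => /ltW. Qed.

Let alpha_gap : 0 < alpha * (2 - alpha).
Proof. by case/andP: alpha02 => a0 a2; apply: mulr_gt0; lra. Qed.

Let fejer p n : Z p -> inner (X n.+1 - p) (X n.+1 - p) <=
  inner (X n - p) (X n - p) - alpha * (2 - alpha) * inner (J n (X n) - X n) (J n (X n) - X n).
Proof. by move=> Zp; rewrite X_step; apply: relaxed_step_fejer => //; exact: Z_fix. Qed.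

Let dist_nonincreasing p n m : Z p -> (n <= m)%N -> enorm (X m - p) <= enorm (X n - p).
Proof.
move=> Zp /subnK <-; elim: (m - n)%N => // j IH; apply: le_trans IH.
rewrite ler_enorm addSn; apply: le_trans (fejer _ Zp) _.
by rewrite gerBl mulr_ge0 ?inner_ge0 // ltW.
Qed.

(** The squared distance to a point of [Z] decreases to its infimum. Once it is within
    [alpha * (2 - alpha) * e ^+ 2] of it, a residual of size [e] would push it below. *)
Lemma relaxed_residual_cvg0 (e : R) : 0 < e ->
  exists N, forall n, (N <= n)%N -> enorm (J n (X n) - X n) < e.
Proof.
move=> e0; have [p Zp] := Z_nonempty; pose d n := inner (X n - p) (X n - p).
pose S := [set d n | n in [set: nat]].
have lS : has_inf S.
  split; first by exists (d 0%N), 0%N.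
  by exists 0 => _ [n _ <-]; exact: inner_ge0.
have eps0 : 0 < alpha * (2 - alpha) * e ^+ 2 by rewrite mulr_gt0 ?exprn_gt0.
have [_ [N _ <-] dN] := inf_adherent eps0 lS; exists N => n Nn.
have dnN : d n <= d N.
  by rewrite /d -!enorm_sqr ler_pXn2r ?nnegrE ?enorm_ge0 // dist_nonincreasing.
have dS : inf S <= d n.+1 by apply: (ge_inf lS.2); exists n.+1.
rewrite -(@ltr_pXn2r _ 2) ?nnegrE ?enorm_ge0 ?(ltW e0) // enorm_sqr.
rewrite -(ltr_pM2l alpha_gap).
have := fejer n Zp; rewrite -/(d n) -/(d n.+1); lra.
Qed.

Lemma relaxed_drift_cvg0 (m : nat) (e : R) : 0 < e ->
  exists N, forall n j, (N <= n)%N -> (j <= m)%N -> enorm (X (n + j)%N - X n) < e.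
Proof.
move=> e0; have d0 : 0 < e / m.+1%:R by rewrite divr_gt0.
(* Since [alpha < 2], halving the bound on the residual bounds each increment by [e / m.+1]. *)
have [N HN] := relaxed_residual_cvg0 (divr_gt0 d0 (ltr0n R 2)).
exists N => n j Nn jm.
have H : enorm (X (n + j)%N - X n) <= j%:R * (e / m.+1%:R).
  elim: j {jm} => [|j IH].
    by rewrite addn0 subrr mul0r /enorm inner0l sqrtr0.
  apply: le_trans (ler_enorm_dist _ (X (n + j)%N) _) _.
  rewrite -natr1 mulrDl mul1r addrC; apply: lerD => //.
  rewrite addnS X_step addrAC subrr add0r enormZ ger0_norm //.
  have := HN (n + j)%N (leq_trans Nn (leq_addr _ _)); rewrite ltr_pdivlMr //.
  have := enorm_ge0 (J (n + j)%N (X (n + j)%N) - X (n + j)%N).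
  set w := enorm _ => w0 wd; have : alpha * w <= 2 * w.
    by case/andP: alpha02 => _ /ltW a2; exact: ler_wpM2r.
  by move=> aw; apply: le_trans aw _; rewrite mulrC; exact: ltW.
apply: le_lt_trans H _; rewrite mulrA ltr_pdivrMr // mulrC ltr_pM2l //.
by rewrite ltr_nat ltnS.
Qed.

Variables (C : countType) (q : C -> 'rV[R]_k) (r : C -> R) (good : set C).
(** The length [m] is fixed before [M]: blocks of one length recur arbitrarily late, where the drift
    over [m] steps is small. The bound on [pickle] cuts out finitely many tests. *)
Hypothesis good_recurrent : forall N, exists m, forall M, exists2 n, (M <= n)%N &
  forall c, (pickle c < N)%N -> good c ->
    exists2 j, (j < m)%N & r c < enorm (J (n + j)%N (q c) - q c).
Hypothesis good_separates : forall x, ~ Z x ->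
  exists2 c, good c & 3 * enorm (q c - x) < r c.

Let good_times N : exists n, forall c, (pickle c < N)%N -> good c ->
  exists j, [/\ enorm (X (n + j)%N - X n) < N.+1%:R^-1,
    enorm (J (n + j)%N (X (n + j)%N) - X (n + j)%N) < N.+1%:R^-1 &
    r c < enorm (J (n + j)%N (q c) - q c)].
Proof.
have e0 : (0 : R) < N.+1%:R^-1 by rewrite invr_gt0.
have [m Hm] := good_recurrent N.
have [N1 HN1] := relaxed_residual_cvg0 e0.
have [N2 HN2] := relaxed_drift_cvg0 m e0.
have [n] := Hm (maxn N1 N2); rewrite geq_max => /andP[N1n N2n] Hn.
exists n => c cN gc; have [j jm rj] := Hn c cN gc.
exists j; split=> //; first by apply: HN2 => //; exact: ltnW.
by apply: HN1; exact: leq_trans N1n (leq_addr _ _).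
Qed.

(** A cluster point along the good times must lie in [Z]; Fejer monotonicity with respect to that
    very point then gives convergence of the whole sequence. *)
Lemma relaxed_iteration_cvg : exists2 l, Z l & X n @[n --> \oo] --> l.
Proof.
have [nu nuP] := choice good_times; have [p Zp] := Z_nonempty.
have Xb n : enorm (X (nu n)) <= enorm (X 0%N - p) + enorm p.
  rewrite -[X (nu n)](subrK p); apply: le_trans (ler_enormD _ _) _.
  by rewrite lerD2r; exact: dist_nonincreasing.
have [l lP] := bounded_seq_cluster Xb; have Zl : Z l.
  apply: contrapT => /good_separates[c gc rc].
  (* The residual at [q c] is at most a residual on the trajectory, plus the drift, plus
     [enorm (X (nu N) - l)], each below [r c / 9], plus [enorm (q c - l) < r c / 3]: less than [r c]
     in total. *)
  have e0 : 0 < r c / 9 by have := enorm_ge0 (q c - l); lra.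
  have [N0 _ HN0] := near_infty_natSinv_lt (PosNum e0).
  have [N] := lP _ e0 (maxn N0 (pickle c).+1).
  rewrite geq_max => /andP[/HN0 /= Ne cN] Nl.
  have [j [Xj rj qj]] := nuP N c cN gc.
  have := residual_lipschitz (q c) (X (nu N + j)%N) (J_firm (nu N + j)%N).
  have := ler_enorm_dist (q c) l (X (nu N + j)%N).
  have := ler_enorm_dist l (X (nu N)) (X (nu N + j)%N).
  rewrite (enormC l (X (nu N))) (enormC (X (nu N)) (X (nu N + j)%N)).
  have := lt_trans Xj Ne; have := lt_trans rj Ne; lra.
exists l => //; apply: cvg_enormP => e e0; have [n _ ln] := lP _ e0 0%N.
exists (nu n) => m nm; exact: le_lt_trans (dist_nonincreasing Zl nm) ln.
Qed.

End RelaxedIteration.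

(** * Recurrence of events along an ergodic stationary sequence *)

Lemma preimage_generated (T U : Type) (f : T -> U) (S : set (set T)) (G : set (set U)) :
  sigma_algebra setT S -> (forall A, G A -> S (f @^-1` A)) ->
  forall B, <<s G >> B -> S (f @^-1` B).
Proof.
move=> [S0 SC SU] GS B; apply: (@smallest_sub _ _ _ [set B | S (f @^-1` B)]) => //.
split=> /=; first by rewrite preimage_set0.
- by move=> A SA; rewrite setTD preimage_setC -setTD; exact: SC.
- by move=> F SF; rewrite preimage_bigcup; exact: SU.
Qed.

Section Recurrence.
Variables (R : realType) (d : measure_display) (I : measurableType d).
Variables (d' : measure_display) (O : measurableType d') (P : probability O R).
Variable xi : nat -> O -> I.
Hypothesis xi_measurable : forall n, measurable_fun setT (xi n).
Hypothesis xi_stationary : stationary P xi.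
Hypothesis xi_ergodic : ergodic P xi.

Lemma path_measurable B : seq_sigma B -> measurable (path_of xi @^-1` B).
Proof.
apply: preimage_generated; first exact: sigma_algebra_measurable.
move=> _ [n [A [mA ->]]]; have := xi_measurable n measurableT mA.
by rewrite setTI.
Qed.

Let shiftn n (w : nat -> I) : nat -> I := fun j => w (n + j)%N.

Lemma cylinder_seq_sigma n (A : set I) : measurable A ->
  seq_sigma ((fun w : nat -> I => w n) @^-1` A).
Proof. by move=> mA; apply: sub_gen_smallest; exists n, A. Qed.

Let shiftn_seq_sigma n B : seq_sigma B -> seq_sigma (shiftn n @^-1` B).
Proof.
apply: preimage_generated; first exact: smallest_sigma_algebra.
by move=> _ [m [A [mA ->]]]; exact: (@cylinder_seq_sigma (n + m)).
Qed.

Let shiftn_stationary n B : seq_sigma B ->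
  P (path_of xi @^-1` (shiftn n @^-1` B)) = P (path_of xi @^-1` B).
Proof.
move=> sB; elim: n => // n IH.
by rewrite -IH -(xi_stationary (shiftn_seq_sigma n sB)).
Qed.

(** The event that [B] holds at infinitely many shifts is invariant. It is the decreasing limit of
    the [U M], each at least as likely as [B], so its probability is positive and hence [1]. *)
Lemma ergodic_recurrence B : seq_sigma B -> P (path_of xi @^-1` B) != 0%E ->
  {ae P, forall o, forall M, exists2 n, (M <= n)%N & B (fun j => xi (n + j)%N o)}.
Proof.
move=> sB PB0; pose U M := \bigcup_n shiftn (M + n) @^-1` B.
have sU M : seq_sigma (U M).
  by apply: sigma_algebra_bigcup => n; exact: shiftn_seq_sigma.
have sI : seq_sigma (\bigcap_M U M).
  exact: (@bigcap_measurableType _ (g_sigma_algebraType _) U setT (fun M _ => sU M)).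
(* Exact invariance holds because shifting turns [U M] into [U M.+1], and the [U M] decrease. *)
have inv : (@Defs.shift I) @^-1` (\bigcap_M U M) = \bigcap_M U M.
  apply/seteqP; split=> w wU M _.
    by have [n _ Bn] := wU M Logic.I; exists n.+1 => //; rewrite addnS.
  by have [n _ Bn] := wU M.+1 Logic.I; exists n.
have le M : (P (path_of xi @^-1` B) <= P (path_of xi @^-1` U M))%E.
  rewrite -(shiftn_stationary M sB); apply: le_measure; rewrite ?inE.
  - exact: (path_measurable (shiftn_seq_sigma M sB)).
  - exact: path_measurable.
  - by move=> o Bo; exists 0%N => //; rewrite addn0.
have PI : P (path_of xi @^-1` \bigcap_M U M) = 1%E.
  have [PI0|//] := xi_ergodic sI inv; exfalso; move/negP: PB0; apply.
  have cv : P (path_of xi @^-1` U M) @[M --> \oo] --> P (\bigcap_M path_of xi @^-1` U M).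
    apply: (@nonincreasing_cvg_mu _ _ _ P (fun M => path_of xi @^-1` U M)).
    - by apply: le_lt_trans (probability_le1 _ _) (ltry _); exact: path_measurable.
    - by move=> M; exact: path_measurable.
    - by rewrite -preimage_bigcap; exact: path_measurable.
    - move=> n m nm; apply/subsetPset => o [j _ Bj].
      by exists (m - n + j)%N => //; rewrite addnA subnKC.
  rewrite eq_le measure_ge0 andbT -PI0 preimage_bigcap.
  by apply: (cvge_ge _ cv); exists 0%N.
exists (~` (path_of xi @^-1` \bigcap_M U M)); split.
- exact/measurableC/path_measurable.
- by rewrite probability_setC ?PI ?subee //; exact: path_measurable.
- move=> o /= H Uo; apply: H => M; have [n _ Bn] := Uo M Logic.I.
  by exists (M + n)%N => //; exact: leq_addr.
Qed.

Variable A : nat -> set I.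
Hypothesis A_measurable : forall i, measurable (A i).
(** Empty members serve as padding when a countable family is indexed by [nat]. *)
Hypothesis A_charged : forall i, P (xi 0%N @^-1` A i) != 0%E \/ A i = set0.

(** The events [B m], that the first [m] terms visit every nonempty [A i] with [i < N], cover almost
    every path; so some [B m] has positive probability, and it recurs. *)
Lemma ergodic_block_recurrence :
  {ae P, forall o, forall N, exists m, forall M, exists2 n, (M <= n)%N &
    forall i, (i < N)%N -> A i !=set0 -> exists2 j, (j < m)%N & A i (xi (n + j)%N o)}.
Proof.
apply: ae_foralln => N.
pose D := [set i | (i < N)%N /\ A i !=set0].
pose B m := \bigcap_(i in D) \bigcup_(j in [set j | (j < m)%N])
  ((fun w : nat -> I => w j) @^-1` A i).
have sB m : seq_sigma (B m).
  apply: (@bigcap_measurableType _ (g_sigma_algebraType _)) => i _.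
  by apply: bigcup_measurable => j _; exact: cylinder_seq_sigma.
have visit : {ae P, forall o, forall i, A i !=set0 -> exists n, A i (xi n o)}.
  apply: ae_foralln => i; have [PA|->] := A_charged i; last first.
    by apply: aeW => o [].
  have := ergodic_recurrence (cylinder_seq_sigma 0 (A_measurable i)) PA.
  apply: filterS => o /(_ 0%N)[n _ An] _; by exists (n + 0)%N.
have [m Pm] : exists m, P (path_of xi @^-1` B m) != 0%E.
  apply: contrapT => nB.
  have nU : P.-negligible (\bigcup_m path_of xi @^-1` B m).
    apply: negligible_bigcup => m; exists (path_of xi @^-1` B m); split=> //.
      exact: path_measurable.
    by apply: contrapT => /eqP Bm; apply: nB; exists m.
  have nT : P.-negligible setT.
    apply: negligibleS (negligibleU visit nU) => o _.
    have [vo|nvo] := pselect (forall i, A i !=set0 -> exists n, A i (xi n o)); last by left.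
    right; have /choice[f fP] i : exists n, A i !=set0 -> A i (xi n o).
      have [/vo[n An]|nA] := pselect (A i !=set0); first by exists n.
      by exists 0%N.
    (* A block reaching just past the latest of the chosen visit times contains them all. *)
    exists (\max_(i < N) f i).+1 => // i [iN Ai]; exists (f i); last exact: fP.
    by rewrite /= ltnS (@leq_bigmax _ (fun i : 'I_N => f i) (Ordinal iN)).
  have PT0 : P setT = 0%E by exact: measure_negligible.
  by have := probability_setT P; rewrite PT0 => /eqP; rewrite eqe eq_sym oner_eq0.
apply: filterS (ergodic_recurrence (sB m) Pm) => o oP; exists m => M.
have [n Mn Bn] := oP M; exists n => // i iN Ai.
by have [|j jm Aj] := Bn i; [split|exists j].
Qed.

End Recurrence.

(** * Borel measurability of random vectors *)

Section BorelVectors.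
Variables (R : realType) (k : nat).

Lemma rat_vec_dense (x : 'rV[R]_k) (e : R) : 0 < e ->
  exists q : 'rV[rat]_k, enorm (map_mx ratr q - x) < e.
Proof.
move=> e0; have [d d0 dP] := enorm_lt_delta k e0.
have /choice[q qP] i : exists q : rat, `|ratr q - x ord0 i| < d.
  have [|q] := @rat_in_itvoo R (x ord0 i - d) (x ord0 i + d); first by lra.
  by rewrite in_itv /= => xq; exists q; rewrite ltr_distl.
exists (\row_i q i); apply: dP => i; rewrite !mxE; exact: qP.
Qed.

Lemma open_borel_vec (A : set 'rV[R]_k) : open A -> borel_vec A.
Proof. by move=> oA; apply: sub_gen_smallest. Qed.

(** An open set is the union of the countably many rational boxes it contains, and the preimage of a
    box is a finite intersection of coordinate events. *)
Lemma coord_measurable_borel d (O : measurableType d) (X : O -> 'rV[R]_k) :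
  (forall i, measurable_fun setT (fun o => X o ord0 i)) ->
  forall B, borel_vec B -> measurable (X @^-1` B).
Proof.
move=> mX; apply: preimage_generated; first exact: sigma_algebra_measurable.
move=> A oA; pose C : countType := ('rV[rat]_k * nat)%type.
pose box (c : C) :=
  \bigcap_(i in [set: 'I_k])
    [set x : 'rV[R]_k | ball (ratr (c.1 ord0 i) : R) c.2.+1%:R^-1 (x ord0 i)].
pose F (c : C) := if `[< box c `<=` A >] then X @^-1` box c else set0.
have -> : X @^-1` A = \bigcup_c F c.
  apply/seteqP; split=> o /=; last first.
    by move=> [c _]; rewrite /F; case: asboolP => // cA; exact: cA.
  move=> AXo; have /nbhs_ballP[e /= e0 eA] := open_nbhs_nbhs (conj oA AXo).
  have [n _ /(_ n (leqnn n)) /= ne] :=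
    near_infty_natSinv_lt (PosNum (divr_gt0 e0 (ltr0n R 2))).
  have n0 : (0 : R) < n.+1%:R^-1 by rewrite invr_gt0.
  have [q qX] := rat_vec_dense (X o) n0.
  have Xq i : `|ratr (q ord0 i) - X o ord0 i| < n.+1%:R^-1.
    by have := coord_le_enorm (map_mx ratr q - X o) i; rewrite !mxE => /le_lt_trans; exact.
  exists (q, n) => //; rewrite /F; case: asboolP => [_ i _|[]]; first exact: Xq.
  move=> y yq; apply: eA; split=> // i j; rewrite ord1; have := yq j Logic.I.
  rewrite /= -!ball_normE /ball_ /= => qy.
  have := ler_distD (ratr (q ord0 j)) (X o ord0 j) (y ord0 j).
  by rewrite [`|X o ord0 j - ratr _|]distrC; have := lt_trans qy ne;
    have := lt_trans (Xq j) ne; lra.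
apply: countable_bigcupT_measurable => [|c]; first exact: countableP.
rewrite /F; case: asboolP => // _; rewrite preimage_bigcap.
apply: fin_bigcap_measurable => [|i _]; first exact: finite_finset.
rewrite -[X in measurable X]setTI; apply: (mX i measurableT).
by apply: open_measurable; apply: ball_open; rewrite invr_gt0.
Qed.

Lemma borel_coord_measurable d (O : measurableType d) (X : O -> 'rV[R]_k) :
  (forall B, borel_vec B -> measurable (X @^-1` B)) ->
  forall i, measurable_fun setT (fun o => X o ord0 i).
Proof.
move=> mX i; apply: (measurability _ (RGenOInfty.measurableE R)).
move=> _ [_ [a ->] <-]; rewrite setTI.
apply: (mX [set x | `]a, +oo[%classic (x ord0 i)]); apply: open_borel_vec.
have oa : open (`]a, +oo[%classic : set R) by exact: interval_open.
have cc : continuous (fun x : 'rV[R]_k => x ord0 i) by exact: coord_continuous.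
exact: ((continuousP _).1 cc _ oa).
Qed.

Lemma jointly_measurable_comp d (I : measurableType d) d' (O : measurableType d')
    (J : I -> 'rV[R]_k -> 'rV[R]_k) (f : O -> I) (X : O -> 'rV[R]_k) :
  jointly_measurable J -> measurable_fun setT f ->
  (forall B, borel_vec B -> measurable (X @^-1` B)) ->
  forall B, borel_vec B -> measurable ((fun o => J (f o) (X o)) @^-1` B).
Proof.
move=> mJ mf mX B /mJ.
apply: (@preimage_generated _ _ (fun o => (f o, X o))).
  exact: sigma_algebra_measurable.
move=> _ [A [B' [mA [mB' ->]]]].
rewrite (_ : _ @^-1` _ = (f @^-1` A) `&` (X @^-1` B')) //.
apply: measurableI; last exact: mX.
by rewrite -[X in measurable X]setTI; exact: mf.
Qed.

Lemma km_iter_measurable d (I : measurableType d) d' (O : measurableType d')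
    (J : I -> 'rV[R]_k -> 'rV[R]_k) (alpha : R) (xi : nat -> O -> I) x0 n i :
  jointly_measurable J -> (forall n, measurable_fun setT (xi n)) ->
  measurable_fun setT (fun o => km_iter J alpha xi x0 n o ord0 i).
Proof.
move=> mJ mxi; elim: n i => [|n IH] i /=; first exact: measurable_cst.
(* Composition with [J] needs the Borel form of measurability, the arithmetic of the step its
   coordinate form. *)
have mJX := borel_coord_measurable
  (jointly_measurable_comp mJ (mxi n) (coord_measurable_borel IH)).
rewrite (_ : (fun o => _) = (fun o => km_iter J alpha xi x0 n o ord0 i +
   alpha * (J (xi n o) (km_iter J alpha xi x0 n o) ord0 i -
            km_iter J alpha xi x0 n o ord0 i))); last first.
  by apply/funext => o; rewrite !mxE.
apply: measurable_funD; first exact: IH.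
apply: measurable_funM; first exact: measurable_cst.
by apply: measurable_funB; [exact: mJX|exact: IH].
Qed.

(** The coordinatewise upper limit is measurable and defined everywhere, and equals the limit where
    there is one; [fine] replaces infinite values by [0]. *)
Definition esup_vec d (O : measurableType d) (X : nat -> O -> 'rV[R]_k) (o : O) : 'rV[R]_k :=
  \row_i fine (limn_esup (fun n => (X n o ord0 i)%:E)).

Lemma esup_vec_measurable d (O : measurableType d) (X : nat -> O -> 'rV[R]_k) :
  (forall n i, measurable_fun setT (fun o => X n o ord0 i)) ->
  forall B, borel_vec B -> measurable (esup_vec X @^-1` B).
Proof.
move=> mX; apply: coord_measurable_borel => i.
rewrite (_ : (fun o => _) =
    fine \o (fun o => limn_esup (fun n => (X n o ord0 i)%:E))); last first.
  by apply/funext => o; rewrite mxE.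
apply: (measurableT_comp (fine_measurable measurableT)).
by apply: measurable_fun_limn_esup => n; apply/measurable_EFinP.
Qed.

Lemma cvg_esup_vec d (O : measurableType d) (X : nat -> O -> 'rV[R]_k) o l :
  X n o @[n --> \oo] --> l -> esup_vec X o = l.
Proof.
move=> Xl; apply/rowP => i; rewrite mxE.
have Xi : X n o ord0 i @[n --> \oo] --> l ord0 i.
  apply: (@cvg_comp _ _ _ (X ^~ o) (fun v : 'rV[R]_k => v ord0 i) _ _ _ Xl).
  exact: coord_continuous.
have : (X n o ord0 i)%:E @[n --> \oo] --> (l ord0 i)%:E.
  by apply/fine_cvgP; split => //; exact: nearW.
by move/cvg_limn_einf_sup => [_ ->].
Qed.

End BorelVectors.

(** * From almost sure properties under [nu] to convergence of the random iteration *)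

Lemma ae_forall_count (R : realType) d (T : measurableType d) (mu : {measure set T -> \bar R})
    (C : countType) (Q : C -> T -> Prop) :
  (forall c, {ae mu, forall t, Q c t}) -> {ae mu, forall t, forall c, Q c t}.
Proof.
move=> aeQ; have : {ae mu, forall t, forall n, forall c, unpickle n = Some c -> Q c t}.
  apply: ae_foralln => n; case: (unpickle n) => [c|]; last exact: aeW.
  by apply: filterS (aeQ c) => t Qt _ [<-].
by apply: filterS => t Qt c; apply: (Qt (pickle c)); exact: pickleK.
Qed.

Lemma ae_distribution (R : realType) d (I : measurableType d) (nu : probability I R)
    d' (O : measurableType d') (P : probability O R) (f : O -> I) (Q : I -> Prop) :
  measurable_fun setT f -> (forall A, measurable A -> P (f @^-1` A) = nu A) ->
  {ae nu, forall i, Q i} -> {ae P, forall o, Q (f o)}.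
Proof.
move=> mf fnu [N [mN nuN NQ]]; exists (f @^-1` N); split.
- by rewrite -[X in measurable X]setTI; exact: mf.
- by rewrite fnu.
- by move=> o /= nQ; apply: NQ.
Qed.

Section RandomResolvents.
Variables (R : realType) (d : measure_display) (I : measurableType d).
Variables (nu : probability I R) (k : nat) (J : I -> 'rV[R]_k -> 'rV[R]_k).
Hypothesis J_firm : forall i, firmly_nonexpansive (J i).
Hypothesis J_measurable : jointly_measurable J.

Let Z : set 'rV[R]_k := [set x | {ae nu, forall i, J i x = x}].

(** The codes serve twice: as balls, by centre and radius, for the separability of [Z], and as
    tests, by point and threshold, for recurrence. *)
Let C : countType := ('rV[rat]_k * nat)%type.
Let q (c : C) : 'rV[R]_k := map_mx ratr c.1.
Let r (c : C) : R := c.2.+1%:R^-1.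
Let A (c : C) := [set i | r c < enorm (J i (q c) - q c)].

Let r_gt0 c : 0 < r c. Proof. by rewrite invr_gt0. Qed.

(** The exceptional null set depends on [p], so one point of [Z] is picked in each rational ball
    meeting [Z]. Almost every [J i] fixes these countably many points, and [residual_lipschitz]
    extends this to all of [Z] by density. *)
Lemma ae_common_fixed_points : {ae nu, forall i, forall p, Z p -> J i p = p}.
Proof.
have [[p0 Zp0]|nZ] := pselect (Z !=set0); last first.
  by apply: aeW => i p Zp; exfalso; apply: nZ; exists p.
have /choice[p pP] (c : C) : exists p, Z p /\
    ((exists2 x, Z x & enorm (x - q c) < r c) -> enorm (p - q c) < r c).
  have [[x Zx xq]|nx] := pselect (exists2 x, Z x & enorm (x - q c) < r c).
    by exists x.
  by exists p0.
have : {ae nu, forall i, forall c, J i (p c) = p c}.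
  by apply: ae_forall_count => c; exact: (pP c).1.
apply: filterS => i Jp x Zx; apply/eqP; rewrite -subr_eq0; apply/eqP/enorm_eq0.
apply/eqP; rewrite eq_le enorm_ge0 andbT; apply/ler_addgt0Pr => e e0; rewrite add0r.
have [n _ /(_ n (leqnn n)) /= ne] :=
    near_infty_natSinv_lt (PosNum (divr_gt0 e0 (ltr0n R 2))).
have n0 : (0 : R) < n.+1%:R^-1 by rewrite invr_gt0.
have [u ux] := rat_vec_dense x n0; pose c : C := (u, n).
have xc : enorm (x - q c) < r c by rewrite enormC.
have pc : enorm (p c - q c) < r c by apply: (pP c).2; exists x.
have := residual_lipschitz x (p c) (J_firm i).
have E0 : enorm (J i (p c) - p c) = 0 by rewrite Jp subrr /enorm inner0l sqrtr0.
have := ler_enorm_dist x (q c) (p c); rewrite E0 (enormC (q c)).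
have := lt_trans xc ne; have := lt_trans pc ne; lra.
Qed.

Let A_measurable c : measurable (A c).
Proof.
have mJ := jointly_measurable_comp J_measurable (@measurable_id _ I setT)
  (coord_measurable_borel (fun i => measurable_cst (q c ord0 i))).
apply: (mJ [set v | r c < enorm (v - q c)]); apply: open_borel_vec.
have cc : continuous (fun v : 'rV[R]_k => enorm (v - q c)).
  move=> v; apply: (@continuous_comp _ _ _ (fun v : 'rV[R]_k => v - q c) (@enorm R k)).
    by apply: (@continuousB _ _ _ id (fun=> q c)); [exact: cvg_id|exact: cst_continuous].
  exact: enorm_continuous.
exact: ((continuousP _).1 cc _ (open_gt (y := r c))).
Qed.

Let charged_separates x : ~ Z x -> exists2 c, nu (A c) != 0%E & 3 * enorm (q c - x) < r c.
Proof.
move=> nZ; have [n An] : exists n, ~ nu.-negligible [set i | n.+1%:R^-1 < enorm (J i x - x)].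
  apply: contrapT => nA; apply: nZ.
  have : nu.-negligible (\bigcup_n [set i | n.+1%:R^-1 < enorm (J i x - x)]).
    by apply: negligible_bigcup => n; apply: contrapT => An; apply: nA; exists n.
  apply: negligibleS => i /= Jx; apply: contrapT => nU; apply: Jx.
  apply/eqP; rewrite -subr_eq0; apply/eqP/enorm_eq0.
  apply/eqP; rewrite eq_le enorm_ge0 andbT; apply/ler_addgt0Pr => e e0; rewrite add0r.
  have [n _ /(_ n (leqnn n)) /= ne] :=
    near_infty_natSinv_lt (PosNum e0).
  rewrite leNgt; apply/negP => ex; apply: nU; exists n => //=; exact: lt_trans ne ex.
set eta : R := n.+1%:R^-1 in An.
have eta0 : 0 < eta by rewrite invr_gt0.
have [|u ux] := rat_vec_dense x (e := eta / 6); first by rewrite divr_gt0.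
(* The threshold is [1 / (2 * n + 2) = eta / 2]. With [q c] within [eta / 6] of [x], a residual
   above [eta] at [x] stays above [eta / 2] at [q c]. *)
pose c : C := (u, (n.*2).+1).
have rc : r c = eta / 2.
  by rewrite /r /= -doubleS -muln2 natrM invfM mulrC.
exists c; last by rewrite rc; have : enorm (q c - x) < eta / 6 by []; lra.
apply/eqP => A0; apply: An; exists (A c); split=> // i /= Jx; rewrite /A /= rc.
have := residual_lipschitz x (q c) (J_firm i); rewrite (enormC x).
have : enorm (q c - x) < eta / 6 by []; lra.
Qed.

Lemma random_relaxation_cvg d' (O : measurableType d') (P : probability O R)
    (xi : nat -> O -> I) (alpha : R) (x0 : 'rV[R]_k) :
  0 < alpha < 2 -> Z !=set0 ->
  (forall n, measurable_fun setT (xi n)) ->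
  (forall n B, measurable B -> P (xi n @^-1` B) = nu B) ->
  stationary P xi -> ergodic P xi ->
  {ae P, forall o, exists2 l, Z l & km_iter J alpha xi x0 n o @[n --> \oo] --> l}.
Proof.
move=> alpha02 Z0 mxi xinu sxi exi.
(* Numbers that code no pair, or a pair of probability zero, receive the empty set. *)
pose A' n := if unpickle n is Some c then if nu (A c) != 0%E then A c else set0 else set0.
have A'c c : nu (A c) != 0%E -> A' (pickle c) = A c by move=> Ac; rewrite /A' pickleK Ac.
have mA' n : measurable (A' n).
  by rewrite /A'; case: (unpickle n) => // c; case: ifP.
have cA' n : P (xi 0%N @^-1` A' n) != 0%E \/ A' n = set0.
  rewrite xinu //; rewrite /A'; case: (unpickle n) => [c|]; last by right.
  by case: ifP => Ac; [left|right].
have := ergodic_block_recurrence mxi sxi exi mA' cA'.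
have : {ae P, forall o, forall n p, Z p -> J (xi n o) p = p}.
  apply: ae_foralln => n.
  exact: (ae_distribution (mxi n) (xinu n) ae_common_fixed_points).
apply: filterS2 => o fixo reco.
apply: (@relaxed_iteration_cvg R k (fun n => J (xi n o)) alpha _ Z _ alpha02 _ _ Z0
  C q r [set c | nu (A c) != 0%E]) => //.
- by move=> p Zp n; exact: fixo.
- move=> N; have [m mP] := reco N; exists m => M; have [n Mn nP] := mP M.
  exists n => // c cN Ac.
  have [|j jm] := nP _ cN; last by rewrite A'c // => Aj; exists j.
  rewrite A'c //; apply/set0P/eqP => Ac0.
  by move: Ac; rewrite /= Ac0 measure0 eqxx.
Qed.

End RandomResolvents.

(** * Almost sure convergence for resolvents of maximal monotone operators *)

Unset Implicit Arguments.

Theorem theoremD (R : realType) (d : measure_display) (I : measurableType d)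
  (nu : probability I R) (k : nat) (T : I -> 'rV[R]_k -> set 'rV[R]_k)
  (lam alpha : R) :
  (forall i, maximal_monotone (T i)) ->
  0 < lam -> 0 < alpha < 2 ->
  jointly_measurable (fun i x => resolvent lam (T i) x) ->
  zero_set nu T !=set0 ->
  forall (d' : measure_display) (O : measurableType d') (P : probability O R)
    (xi : nat -> O -> I),
  (forall n, measurable_fun setT (xi n)) ->
  (forall n A, measurable A -> P (xi n @^-1` A) = nu A) ->
  stationary P xi -> ergodic P xi ->
  forall x0 : 'rV[R]_k,
  exists X : O -> 'rV[R]_k,
    (forall B, borel_vec B -> measurable (X @^-1` B)) /\
    {ae P, forall o,
       km_iter (fun i x => resolvent lam (T i) x) alpha xi x0 n o @[n --> \oo]
         --> X o} /\
    {ae P, forall o, zero_set nu T (X o)}.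
Proof.
move=> mT lam0 alpha02 mJ Z0 d' O P xi mxi xinu sxi exi x0.
set J := fun i x => resolvent lam (T i) x.
(* Zeros become fixed points of the resolvents, which brings the problem to firmly nonexpansive
   maps. *)
have ZE : zero_set nu T = [set x | {ae nu, forall i, J i x = x}].
  apply/seteqP; split=> x /=; apply: filterS => i;
    by move/(resolvent_fixP (mT i) lam0).
have fJ i : firmly_nonexpansive (J i).
  by move=> x y; exact: (resolvent_firmly_nonexpansive (mT i) lam0).
rewrite ZE in Z0 *.
have cvgX := random_relaxation_cvg fJ mJ x0 alpha02 Z0 mxi xinu sxi exi.
exists (esup_vec (km_iter J alpha xi x0)); split; last split.
- by apply: esup_vec_measurable => n i; exact: km_iter_measurable.
- by apply: filterS cvgX => o [l _ Xl]; rewrite (cvg_esup_vec Xl).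
- by apply: filterS cvgX => o [l Zl Xl]; rewrite (cvg_esup_vec Xl).
Qed.
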